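(* Let $U_L=(h_L,u_L,a_L)$ be any state and $U_R=(h_R,u_R,a_R)$ with $a_L<a_R$. Let $\{U_1\}=SW(\mathcal C_-\cap\{a=a_L\},a_R)\cap\mathcal W_2^B(U_R)\cap A_2$, let $U_2=(h_2,u_2,a_L)\in\mathcal C_-$ be such that $U_1=SW(U_2,a_R)$ (meaning $U_1$ is one of the values of $SW(U_2,a_R)$), and let $\{U_3\}=\mathcal W_2^B(U_2)\cap\mathcal W_1(U_L)$, $U_3=(h_3,u_3,a_L)$ (these states being assumed to exist). Let $\bar h_1$ be the $h$-component of the state $\bar U_1$ associated with $U_1$. If $h_R\ge\bar h_1$ and $h_3\le h_2$, then the Riemann problem for the shallow water equations with data $(U_L,U_R)$ has an admissible solution with the structure $$W_1(U_L,U_3)\oplus R_2(U_3,U_2)\oplus W_3(U_2,U_1)\oplus W_2(U_1,U_R),$$ where $R_2(U_3,U_2)$ is a 2-rarefaction wave.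
   Context: System: $\partial_t h+\partial_x(hu)=0$, $\partial_t(hu)+\partial_x\big(h(u^2+g h/2)\big)=-gh\,\partial_x a$, $\partial_t a=0$, with $g>0$ constant, state $U=(h,u,a)$, $h>0$. The Riemann problem with data $(U_L,U_R)$ has initial condition $U_L$ for $x<0$ and $U_R$ for $x>0$. Characteristic speeds: $\lambda_1(U)=u-\sqrt{gh}$, $\lambda_2(U)=u+\sqrt{gh}$, $\lambda_3(U)=0$. Regions: $A_1=\{\lambda_2>\lambda_1>0\}$, $A_2=\{\lambda_2>0>\lambda_1\}$, $A_2^-=A_2\cap\{u<0\}$, $A_3=\{0>\lambda_2>\lambda_1\}$; $\mathcal C_\pm=\{u=\pm\sqrt{gh}\}$, $\mathcal C=\mathcal C_+\cup\mathcal C_-$. Wave curves (all with $a=a_0$ fixed, $h>0$), for $U_0=(h_0,u_0,a_0)$. $\mathcal W_1(U_0)$ is the set of right-hand states $(h,u,a_0)$ with $u=u_0-\sqrt{g/2}\,(h-h_0)\sqrt{1/h+1/h_0}$ if $h>h_0$ (1-shock) and $u=u_0-2\sqrt g(\sqrt h-\sqrt{h_0})$ if $h\le h_0$ (1-rarefaction). $\mathcal W_2^B(U_0)$ is the set of left-hand states $(h,u,a_0)$ with $u=u_0+\sqrt{g/2}\,(h-h_0)\sqrt{1/h+1/h_0}$ if $h>h_0$ (2-shock) and $u=u_0+2\sqrt g(\sqrt h-\sqrt{h_0})$ if $h\le h_0$ (2-rarefaction). The forward 2-shock curve $\mathcal S_2(U_0)$ is the set of right-hand states with $u=u_0+\sqrt{g/2}\,(h-h_0)\sqrt{1/h+1/h_0}$,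 $0<h<h_0$. A shock joining $U_0$ and $U$ has speed $\bar\lambda=(hu-h_0u_0)/(h-h_0)$; an $i$-rarefaction from $U$ to $V$ occupies the speeds $[\lambda_i(U),\lambda_i(V)]$. For $U\in A_2^-$ (which is the case for $U_1$, since $U_1\in A_2$ is joined by a stationary wave to a state of $\mathcal C_-$), $\bar U$ denotes the state on $\mathcal S_2(U)$ for which the shock speed between $U$ and $\bar U$ is $0$; $\bar h$ is its $h$-component. Stationary waves: a stationary wave (speed $0$) joins $U_0$ to $U$ when $hu=h_0u_0$ and $\frac{u^2}{2}+g(h+a)=\frac{u_0^2}{2}+g(h_0+a_0)$. For $u_0\ne0$ let $\varphi(h)=a_0-a+\frac{u_0^2}{2g}\big(\frac{h_0^2}{h^2}-1\big)+h-h_0$, $h_{\min}(U_0)=(u_0^2h_0^2/g)^{1/3}$ and $a_{\min}(U_0)=a_0+\frac{u_0^2}{2g}\big(\frac{h_0^2}{h_{\min}^2}-1\big)+h_{\min}-h_0$; if $a\ge a_{\min}(U_0)$, let $h_*\le h_{\min}\le h^*$ be the roots of $\varphi$ in $(0,\infty)$. $SW(U_0,a)$ is the state $(h,h_0u_0/h,a)$ with $h=h_*$ if $U_0\in A_1\cup A_3$ and $h=h^*$ if $U_0\in A_2$, $u_0\neq 0$; if $U_0\in\mathcal C$ both values $h_*,h^*$ are allowed ($SW$ is two-valued); if $u_0=0$, $SW(U_0,a)=(h_0+a_0-a,0,a)$ (when $h_0+a_0-a>0$). For a set $S$ of states, $SW(S,a)$ is the set of all values $SW(U,a)$, $U\in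 S$. $W_i(U,V)$ denotes the (possibly trivial) $i$-wave with left state $U$ and right state $V$: a Lax shock or rarefaction for $i=1,2$, a stationary wave for $i=3$. $W_i(U,V)\oplus W_j(V,Z)$ means that $W_i(U,V)$ is followed by $W_j(V,Z)$. Such a concatenation from $U_L$ to $U_R$ is an admissible solution of the Riemann problem when each wave is admissible, the waves can be placed in this order from left to right in the $(x,t)$-plane (all speeds in each wave are $\le$ all speeds in the next wave), and the Monotonicity Criterion holds: along each stationary wave, $a$ varies monotonically in $h$ on the curve $h\mapsto\big(u=\frac{h_0u_0}{h},\,a=a_0+\frac{u^2-u_0^2}{2g}+h-h_0\big)$, and the total variation of $a$ in the solution is $|a_L-a_R|$.
   Formalization: Stationary waves are taken to satisfy a = a_0 + (u²−u_0²)/(2g) + h − h_0, the sign used in φ, SW and the Monotonicity Criterion, instead of u²/2 + g(h+a) = const, which together with U_1 = SW(U_2,a_R) would force a_L = a_R. *)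

(* Defs.v *)
From HB Require Import structures.
From mathcomp Require Import all_boot all_order all_algebra.
From mathcomp Require Import boolp classical_sets reals exp.
Set Implicit Arguments.
Unset Strict Implicit.
Unset Printing Implicit Defensive.
Import Order.TTheory GRing.Theory Num.Theory.
Local Open Scope classical_set_scope.
Local Open Scope ring_scope.

(* Depth h, velocity u and bottom level a.  The requirement h > 0 is part of
   the sets and relations below. *)
Record state (R : realType) := State { depth : R; vel : R; bottom : R }.

Inductive family := F1 | F2 | F3.

Definition lambda (R : realType) (g : R) (i : family) (U : state R) : R :=
  match i with
  | F1 => vel U - Num.sqrt (g * depth U)
  | F2 => vel U + Num.sqrt (g * depth U)
  | F3 => 0
  end.

Definition A1 (R : realType) (g : R) : set (state R) :=
  [set U | 0 < depth U /\ 0 < lambda g F1 U < lambda g F2 U].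

Definition A2 (R : realType) (g : R) : set (state R) :=
  [set U | 0 < depth U /\ lambda g F1 U < 0 < lambda g F2 U].

Definition A3 (R : realType) (g : R) : set (state R) :=
  [set U | 0 < depth U /\ lambda g F1 U < lambda g F2 U < 0].

Definition Cplus (R : realType) (g : R) : set (state R) :=
  [set U | 0 < depth U /\ vel U = Num.sqrt (g * depth U)].

Definition Cminus (R : realType) (g : R) : set (state R) :=
  [set U | 0 < depth U /\ vel U = - Num.sqrt (g * depth U)].

Definition hugoniot (R : realType) (g h0 h : R) : R :=
  Num.sqrt (g / 2) * (h - h0) * Num.sqrt (h^-1 + h0^-1).

Definition riemann (R : realType) (g h0 h : R) : R :=
  2 * Num.sqrt g * (Num.sqrt h - Num.sqrt h0).

(* W1 and S2 consist of right-hand states, W2B of left-hand states. *)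
Definition W1 (R : realType) (g : R) (U0 : state R) : set (state R) :=
  [set U | [/\ bottom U = bottom U0, 0 < depth U &
    vel U = if depth U0 < depth U
            then vel U0 - hugoniot g (depth U0) (depth U)
            else vel U0 - riemann g (depth U0) (depth U)]].

Definition W2B (R : realType) (g : R) (U0 : state R) : set (state R) :=
  [set U | [/\ bottom U = bottom U0, 0 < depth U &
    vel U = if depth U0 < depth U
            then vel U0 + hugoniot g (depth U0) (depth U)
            else vel U0 + riemann g (depth U0) (depth U)]].

Definition S2 (R : realType) (g : R) (U0 : state R) : set (state R) :=
  [set U | [/\ bottom U = bottom U0, 0 < depth U < depth U0 &
    vel U = vel U0 + hugoniot g (depth U0) (depth U)]].

Definition shock_speed (R : realType) (U0 U : state R) : R :=
  (depth U * vel U - depth U0 * vel U0) / (depth U - depth U0).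

(* The state written with a bar over U0 is the element of this set. *)
Definition S2_still (R : realType) (g : R) (U0 : state R) : set (state R) :=
  [set U | S2 g U0 U /\ shock_speed U0 U = 0].

Definition phi (R : realType) (g : R) (U0 : state R) (a h : R) : R :=
  bottom U0 - a
  + vel U0 ^+ 2 / (2 * g) * (depth U0 ^+ 2 / h ^+ 2 - 1) + h - depth U0.

Definition hmin (R : realType) (g : R) (U0 : state R) : R :=
  (vel U0 ^+ 2 * depth U0 ^+ 2 / g) `^ (3%:R^-1).

Definition amin (R : realType) (g : R) (U0 : state R) : R :=
  bottom U0
  + vel U0 ^+ 2 / (2 * g) * (depth U0 ^+ 2 / hmin g U0 ^+ 2 - 1)
  + hmin g U0 - depth U0.

Definition lower_root (R : realType) (g : R) (U0 : state R) (a h : R) : Prop :=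
  [/\ 0 < h, h <= hmin g U0 & phi g U0 a h = 0].

Definition upper_root (R : realType) (g : R) (U0 : state R) (a h : R) : Prop :=
  [/\ 0 < h, hmin g U0 <= h & phi g U0 a h = 0].

(* [SW g U0 a] is a set because SW is two-valued on Cplus and Cminus and
   undefined when vel U0 <> 0 and a < amin.  The case vel U0 = 0 keeps h + a
   constant, whereas the zeros of [phi] with vel U0 = 0 keep h - a constant. *)
Definition SW (R : realType) (g : R) (U0 : state R) (a : R) : set (state R) :=
  [set U | [/\ bottom U = a, 0 < depth U &
    if vel U0 == 0
    then vel U = 0 /\ depth U = depth U0 + bottom U0 - a
    else [/\ amin g U0 <= a, vel U = depth U0 * vel U0 / depth U &
           [\/ (A1 g `|` A3 g) U0 /\ lower_root g U0 a (depth U),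
               A2 g U0 /\ upper_root g U0 a (depth U) |
               (Cplus g `|` Cminus g) U0 /\
                 (lower_root g U0 a (depth U) \/
                  upper_root g U0 a (depth U))]]]].

Definition SWset (R : realType) (g : R) (S : set (state R)) (a : R) :
    set (state R) :=
  \bigcup_(U in S) SW g U a.

Definition rankine_hugoniot (R : realType) (g s : R) (U V : state R) : Prop :=
  [/\ bottom V = bottom U,
      depth V * vel V - depth U * vel U = s * (depth V - depth U) &
      depth V * (vel V ^+ 2 + g * depth V / 2)
        - depth U * (vel U ^+ 2 + g * depth U / 2)
      = s * (depth V * vel V - depth U * vel U)].

Definition lax_shock (R : realType) (g : R) (i : family) (U V : state R) :
    Prop :=
  [/\ 0 < depth U, 0 < depth V,
      rankine_hugoniot g (shock_speed U V) U V &
      lambda g i V < shock_speed U V < lambda g i U].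

(* Equality of depths (the trivial wave U = V) is allowed. *)
Definition rarefaction (R : realType) (g : R) (i : family) (U V : state R) :
    Prop :=
  match i with
  | F1 => W1 g U V /\ depth V <= depth U
  | F2 => W2B g V U /\ depth U <= depth V
  | F3 => False
  end.

(* Bottom level along the stationary curve through U0; the zeros of
   [phi g U0 a] are the h > 0 with [stationary_bottom g U0 h = a].  The sign of
   the bottom level is thus that of [phi], [amin] and the curve in the
   Monotonicity Criterion, for which the critical states minimize a.  It is
   opposite to the sign in u^2/2 + g(h + a) = const, with which no state with
   a > bottom U0 can be reached from a critical U0. *)
Definition stationary_bottom (R : realType) (g : R) (U0 : state R) (h : R) : R :=
  bottom U0
  + ((depth U0 * vel U0 / h) ^+ 2 - vel U0 ^+ 2) / (2 * g) + h - depth U0.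

Definition stationary (R : realType) (g : R) (U V : state R) : Prop :=
  [/\ 0 < depth U, 0 < depth V,
      depth V * vel V = depth U * vel U &
      bottom V = stationary_bottom g U (depth V)].

Definition monotone_bottom (R : realType) (g : R) (U V : state R) : Prop :=
  let D h := Num.min (depth U) (depth V) <= h <= Num.max (depth U) (depth V) in
  let f := stationary_bottom g U in
  (forall h k, D h -> D k -> h <= k -> f h <= f k) \/
  (forall h k, D h -> D k -> h <= k -> f k <= f h).

(* [Wave i U V] is the candidate i-wave with left state U and right state V. *)
Record wave (R : realType) :=
  Wave { wfam : family; wleft : state R; wright : state R }.

Definition admissible_wave (R : realType) (g : R) (w : wave R) : Prop :=
  match wfam w with
  | F3 => stationary g (wleft w) (wright w)
  | i => lax_shock g i (wleft w) (wright w) \/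
         rarefaction g i (wleft w) (wright w)
  end.

Definition speeds (R : realType) (g : R) (w : wave R) : set R :=
  [set s |
    match wfam w with
    | F3 => s = 0
    | i => (lax_shock g i (wleft w) (wright w) /\
              s = shock_speed (wleft w) (wright w)) \/
           (rarefaction g i (wleft w) (wright w) /\
              lambda g i (wleft w) <= s <= lambda g i (wright w))
    end].

Fixpoint every (T : Type) (P : T -> Prop) (s : seq T) : Prop :=
  match s with
  | [::] => True
  | x :: s' => P x /\ every P s'
  end.

Fixpoint connects (R : realType) (UL : state R) (ws : seq (wave R))
    (UR : state R) : Prop :=
  match ws with
  | [::] => UL = UR
  | w :: ws' => wleft w = UL /\ connects (wright w) ws' UR
  end.

Definition precedes (R : realType) (g : R) (w w' : wave R) : Prop :=
  forall s s', speeds g w s -> speeds g w' s' -> s <= s'.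

Fixpoint ordered (R : realType) (g : R) (ws : seq (wave R)) : Prop :=
  match ws with
  | w :: ((w' :: _) as ws') => precedes g w w' /\ ordered g ws'
  | _ => True
  end.

Definition monotonicity_criterion (R : realType) (g : R) (UL UR : state R)
    (ws : seq (wave R)) : Prop :=
  every (fun w => wfam w = F3 -> monotone_bottom g (wleft w) (wright w)) ws /\
  \sum_(w <- ws) `|bottom (wright w) - bottom (wleft w)|
    = `|bottom UL - bottom UR|.

Definition admissible_solution (R : realType) (g : R) (UL UR : state R)
    (ws : seq (wave R)) : Prop :=
  [/\ connects UL ws UR,
      every (admissible_wave g) ws,
      ordered g ws &
      monotonicity_criterion g UL UR ws].

(* Main.v *)
(** Along a Hugoniot curve the velocity jump is [k * (h - h0)] with
    [k = ± sqrt (g/2) sqrt (1/h + 1/h0)], and the shock speed is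
    [u0 + k h = u + k h0].  The Rankine-Hugoniot and Lax conditions then follow
    from [k^2 = g (h + h0) / (2 h h0)], and for 2-shocks issuing from [U1] the
    speed increases with [h]; since it vanishes at [U1bar], the shock from [U1]
    to [UR] can be placed to the right of the stationary wave.  As [U2] is
    critical, [lambda g F2 U2 = 0], so that the rarefaction ends at speed 0, and
    the bottom level along the stationary curve is minimal at [U2], hence
    monotone on either side of it. *)
Require Import Defs.
From HB Require Import structures.
From mathcomp Require Import all_boot all_order all_algebra.
From mathcomp Require Import boolp classical_sets reals exp.
From mathcomp Require Import ring lra.
Set Implicit Arguments.
Unset Strict Implicit.
Unset Printing Implicit Defensive.
Import Order.TTheory GRing.Theory Num.Theory.
Local Open Scope classical_set_scope.
Local Open Scope ring_scope.

(** * Chord slopes of the Hugoniot curves in the (h, u)-plane *)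

Definition slope (R : realType) (g h0 h : R) : R :=
  Num.sqrt (g / 2) * Num.sqrt (h^-1 + h0^-1).

Lemma slopeC (R : realType) (g h0 h : R) : slope g h0 h = slope g h h0.
Proof. by rewrite /slope addrC. Qed.

Lemma hugoniotE (R : realType) (g h0 h : R) :
  hugoniot g h0 h = slope g h0 h * (h - h0).
Proof. by rewrite /hugoniot /slope mulrAC. Qed.

Lemma hugoniotC (R : realType) (g h0 h : R) :
  hugoniot g h0 h = - hugoniot g h h0.
Proof. by rewrite !hugoniotE slopeC -mulrN opprB. Qed.

Lemma slope_ge0 (R : realType) (g h0 h : R) : 0 <= slope g h0 h.
Proof. by rewrite mulr_ge0 ?sqrtr_ge0. Qed.

Lemma slopeM_ge0 (R : realType) (g h0 h a : R) :
  0 <= a -> 0 <= slope g h0 h * a.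
Proof. by move=> a0; rewrite mulr_ge0 ?slope_ge0. Qed.

Lemma slope_sqr (R : realType) (g h0 h : R) : 0 < g -> 0 < h0 -> 0 < h ->
  slope g h0 h ^+ 2 = g / 2 * (h^-1 + h0^-1).
Proof.
move=> g0 h00 h0'; rewrite exprMn !sqr_sqrtr //.
  by rewrite addr_ge0 ?invr_ge0 ?ltW.
by rewrite divr_ge0 ?ltW.
Qed.

(** Squaring reduces this to a (a + b) < 2 b^2. It yields the Lax inequality on the deeper side of a
    shock, for both families. *)
Lemma slope_lt_sqrt (R : realType) (g a b : R) : 0 < g -> 0 < a -> a < b ->
  slope g a b * a < Num.sqrt (g * b).
Proof.
move=> g0 a0 ab; have b0 := lt_trans a0 ab.
rewrite -(@ltr_pXn2r _ 2) ?nnegrE ?sqrtr_ge0 ?slopeM_ge0 ?ltW //.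
rewrite exprMn slope_sqr // sqr_sqrtr ?mulr_ge0 ?ltW //.
have -> : g / 2 * (b^-1 + a^-1) * a ^+ 2 = g * (a * (a + b) / (2 * b)).
  by field; rewrite !gt_eqF.
rewrite ltr_pM2l // ltr_pdivrMr ?mulr_gt0 //; nra.
Qed.

(** Squaring reduces this to 2 a^2 < b (a + b), which yields the Lax inequality on the shallower
    side. *)
Lemma sqrt_lt_slope (R : realType) (g a b : R) : 0 < g -> 0 < a -> a < b ->
  Num.sqrt (g * a) < slope g a b * b.
Proof.
move=> g0 a0 ab; have b0 := lt_trans a0 ab.
rewrite -(@ltr_pXn2r _ 2) ?nnegrE ?sqrtr_ge0 ?slopeM_ge0 ?ltW //.
rewrite exprMn slope_sqr // sqr_sqrtr ?mulr_ge0 ?ltW //.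
have -> : g / 2 * (b^-1 + a^-1) * b ^+ 2 = g * (b * (a + b) / (2 * a)).
  by field; rewrite !gt_eqF.
rewrite ltr_pM2l // ltr_pdivlMr ?mulr_gt0 //; nra.
Qed.

(** The square is g / (2 h0) times h (h + h0), which increases with h > 0. *)
Lemma slopeM_homo (R : realType) (g h0 h k : R) :
  0 < g -> 0 < h0 -> 0 < h -> h <= k ->
  slope g h0 h * h <= slope g h0 k * k.
Proof.
move=> g0 h00 hp hk; have kp := lt_le_trans hp hk.
rewrite -(@ler_pXn2r _ 2) ?nnegrE ?slopeM_ge0 ?(ltW hp) ?(ltW kp) //.
rewrite [leLHS]exprMn [leRHS]exprMn !slope_sqr //.
have E x : 0 < x ->
    g / 2 * (x^-1 + h0^-1) * x ^+ 2 = g / (2 * h0) * (x * (x + h0)).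
  by move=> x0; field; rewrite !gt_eqF.
rewrite !E // ler_pM2l ?divr_gt0 ?mulr_gt0 //; nra.
Qed.

(** * Shocks and rarefactions *)

Section JumpOfSlope.
Variables (R : realType) (g k : R) (U V : state R).
Hypothesis velV : vel V = vel U + k * (depth V - depth U).
Hypothesis dUV : depth V != depth U.

Lemma shock_speedEl : shock_speed U V = vel U + k * depth V.
Proof. by rewrite /shock_speed velV; field; rewrite subr_eq0. Qed.

Lemma shock_speedEr : shock_speed U V = vel V + k * depth U.
Proof. by rewrite shock_speedEl velV; ring. Qed.

Lemma rankine_hugoniot_slope : 0 < depth U -> 0 < depth V ->
  bottom V = bottom U -> k ^+ 2 = g / 2 * ((depth V)^-1 + (depth U)^-1) ->
  rankine_hugoniot g (shock_speed U V) U V.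
Proof.
move=> U0 V0 bUV k2; split=> //; rewrite shock_speedEl velV; first by ring.
have {}k2 : k ^+ 2 * depth U * depth V = g / 2 * (depth U + depth V).
  by rewrite k2; field; rewrite !gt_eqF.
apply/eqP; rewrite -subr_eq0; apply/eqP.
(* The defect in the momentum condition factors; the second factor vanishes by the value of k^2,
   whatever the sign of k, so both families are covered. *)
transitivity ((depth V - depth U) *
    (g / 2 * (depth U + depth V) - k ^+ 2 * depth U * depth V)).
  by field.
by rewrite k2 subrr mulr0.
Qed.

End JumpOfSlope.

(** The bound by [vel V] serves to place the shock to the left of a 2-wave issuing from [V]. *)
Lemma lax_shock_F1 (R : realType) (g : R) (U V : state R) :
  0 < g -> 0 < depth U -> depth U < depth V -> W1 g U V ->
  lax_shock g F1 U V /\ shock_speed U V <= vel V.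
Proof.
move=> g0 U0 UV [bV V0]; rewrite UV hugoniotE -mulNr => velV.
have dUV : depth V != depth U by rewrite gt_eqF.
split; last first.
  by rewrite (shock_speedEr velV dUV) gerDl mulNr oppr_le0 slopeM_ge0 ?ltW.
split=> //.
  by apply: (rankine_hugoniot_slope velV dUV) => //; rewrite sqrrN slope_sqr.
apply/andP; split.
  by rewrite (shock_speedEr velV dUV) /= ltrD2l mulNr ltrN2 slope_lt_sqrt.
by rewrite (shock_speedEl velV dUV) /= ltrD2l mulNr ltrN2 sqrt_lt_slope.
Qed.

(** [W2B] is based at the right-hand state; the antisymmetry of [hugoniot] moves the base point to
    the left-hand one. *)
Lemma W2B_shock (R : realType) (g : R) (U V : state R) :
  depth V < depth U -> W2B g V U ->
  vel V = vel U + slope g (depth U) (depth V) * (depth V - depth U).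
Proof.
by move=> VU [_ _]; rewrite VU hugoniotC hugoniotE => ->; rewrite subrK.
Qed.

Lemma lax_shock_F2 (R : realType) (g : R) (U V : state R) :
  0 < g -> 0 < depth V -> depth V < depth U -> W2B g V U ->
  lax_shock g F2 U V.
Proof.
move=> g0 V0 VU WU; have velV := W2B_shock VU WU; have [bU U0 _] := WU.
have dUV : depth V != depth U by rewrite lt_eqF.
split=> //.
  by apply: (rankine_hugoniot_slope velV dUV) => //; rewrite slope_sqr.
apply/andP; split.
  by rewrite (shock_speedEr velV dUV) /= ltrD2l slopeC sqrt_lt_slope.
by rewrite (shock_speedEl velV dUV) /= ltrD2l slopeC slope_lt_sqrt.
Qed.

(** Across a rarefaction the characteristic speed grows by 3 sqrt g times the gap between the roots
    of the depths, whereas a Lax shock makes it drop strictly. This rules out the spurious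
    alternative in [speeds]. *)
Lemma rarefaction_not_lax (R : realType) (g : R) (i : Defs.family) (U V : state R) :
  0 < g -> rarefaction g i U V -> ~ lax_shock g i U V.
Proof.
move=> g0 rUV [U0 V0 _ /andP[ls sl]]; have := lt_trans ls sl.
suff l : lambda g i U <= lambda g i V by rewrite ltNge l.
have sM x : Num.sqrt (g * x) = Num.sqrt g * Num.sqrt x by rewrite sqrtrM ?ltW.
have sg := sqrtr_ge0 g.
case: i rUV {ls sl} => //= -[[_ _]] + dUV; rewrite ltNge dUV /= => ->;
  have sUV := ler_wsqrtr dUV; rewrite !sM /riemann; nra.
Qed.

(** * Bottom level along the stationary curve of a critical state *)

Lemma stationary_bottom_critical (R : realType) (g : R) (U : state R) (h : R) :
  0 < g -> 0 < h -> Cminus g U ->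
  stationary_bottom g U h =
    bottom U + depth U ^+ 3 / (2 * h ^+ 2) + h - 3 / 2 * depth U.
Proof.
move=> g0 h0 [U0 velU]; rewrite /stationary_bottom !exprMn velU sqrrN.
rewrite sqr_sqrtr ?mulr_ge0 ?ltW //; field.
by rewrite !gt_eqF.
Qed.

Lemma stationary_bottom_homo (R : realType) (g : R) (U : state R) (h k : R) :
  0 < g -> Cminus g U -> depth U <= h -> h <= k ->
  stationary_bottom g U h <= stationary_bottom g U k.
Proof.
move=> g0 UC Uh hk; have U0 := UC.1.
have h0 := lt_le_trans U0 Uh; have k0 := lt_le_trans h0 hk.
rewrite !stationary_bottom_critical // -subr_ge0.
set d := depth U in Uh U0 *.
have -> : bottom U + d ^+ 3 / (2 * k ^+ 2) + k - 3 / 2 * d -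
    (bottom U + d ^+ 3 / (2 * h ^+ 2) + h - 3 / 2 * d) =
    (k - h) * (2 * (h ^+ 2 * k ^+ 2) - (d ^+ 3 * h + d ^+ 3 * k))
      / (2 * h ^+ 2 * k ^+ 2).
  by field; rewrite !gt_eqF.
rewrite divr_ge0 ?mulr_ge0 ?exprn_ge0 ?subr_ge0 // ?(ltW h0) ?(ltW k0) //.
have dk := le_trans Uh hk.
(* The sign of the second factor follows by adding this bound for (h, k) and for (k, h). *)
have E (x y : R) : d <= x -> d <= y -> d ^+ 3 * x <= x ^+ 2 * y ^+ 2.
  move=> dx dy; have x0 := lt_le_trans U0 dx.
  rewrite expr2 -mulrA mulrC ler_pM2l // exprS.
  by apply: ler_pM; rewrite ?exprn_ge0 ?(ltW U0) // lerXn2r // ?nnegrE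
    ltW // (lt_le_trans U0).
rewrite mulr_natl mulr2n lerD ?E // [X in _ <= X]mulrC; exact: E.
Qed.

Lemma stationary_bottom_nhomo (R : realType) (g : R) (U : state R) (h k : R) :
  0 < g -> 0 < h -> Cminus g U -> k <= depth U -> h <= k ->
  stationary_bottom g U k <= stationary_bottom g U h.
Proof.
move=> g0 h0 UC kU hk; have U0 := UC.1.
have k0 := lt_le_trans h0 hk.
rewrite !stationary_bottom_critical // -subr_ge0.
set d := depth U in kU U0 *.
have -> : bottom U + d ^+ 3 / (2 * h ^+ 2) + h - 3 / 2 * d -
    (bottom U + d ^+ 3 / (2 * k ^+ 2) + k - 3 / 2 * d) =
    (k - h) * ((d ^+ 3 * h + d ^+ 3 * k) - 2 * (h ^+ 2 * k ^+ 2))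
      / (2 * h ^+ 2 * k ^+ 2).
  by field; rewrite !gt_eqF.
rewrite divr_ge0 ?mulr_ge0 ?exprn_ge0 ?subr_ge0 // ?(ltW h0) ?(ltW k0) //.
have hd := le_trans hk kU.
have E (x y : R) : 0 < x -> 0 < y -> x <= d -> y <= d ->
    x ^+ 2 * y ^+ 2 <= d ^+ 3 * x.
  move=> x0 y0 xd yd.
  rewrite [x ^+ 2]expr2 -mulrA [X in _ <= X]mulrC ler_pM2l // [d ^+ 3]exprS.
  by apply: ler_pM; rewrite ?exprn_ge0 ?(ltW x0) ?(ltW y0) // lerXn2r // ?nnegrE
    ltW.
rewrite mulr_natl mulr2n lerD ?E // mulrC; exact: E.
Qed.

(** The critical depth is an endpoint of the depth interval, which thus lies on one side of the
    minimum, whichever root [SW] selects. *)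
Lemma monotone_bottom_critical (R : realType) (g : R) (U V : state R) :
  0 < g -> Cminus g U -> 0 < depth V -> monotone_bottom g U V.
Proof.
move=> g0 UC V0; case: (leP (depth U) (depth V)) => UV.
  left=> h k /andP[hU _] _ hk.
  by apply: stationary_bottom_homo => //; rewrite min_l in hU.
right=> h k /andP[hV _] /andP[_ kU] hk; rewrite (min_r (ltW UV)) in hV.
rewrite (max_l (ltW UV)) in kU.
by apply: stationary_bottom_nhomo => //; exact: lt_le_trans V0 hV.
Qed.

(** In every branch with nonzero velocity the depth is a zero of [phi], which is [stationary_bottom]
    minus [a]. *)
Lemma SW_stationary (R : realType) (g : R) (U V : state R) (a : R) :
  0 < g -> 0 < depth U -> vel U != 0 -> SW g U a V -> stationary g U V.
Proof.
move=> g0 U0 /negPf uU [bV V0]; rewrite uU => -[_ velV root].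
split=> //; first by rewrite velV; field; rewrite gt_eqF.
have : phi g U a (depth V) = 0.
  by case: root => [[_ []]|[_ []]|[_ [[]|[]]]].
rewrite bV => /eqP; rewrite /phi => E.
apply/eqP; rewrite eq_sym -subr_eq0 -(eqP E); apply/eqP.
by rewrite /stationary_bottom; field; rewrite !gt_eqF.
Qed.

(** * Signs of the speeds and assembly of the four waves *)

Lemma lambda2_Cminus (R : realType) (g : R) (U : state R) :
  Cminus g U -> lambda g F2 U = 0.
Proof. by case=> _ /= ->; rewrite addNr. Qed.

Lemma shock_speed_ge0 (R : realType) (g : R) (U Ubar V : state R) :
  0 < g -> S2_still g U Ubar -> W2B g V U ->
  depth Ubar <= depth V -> depth V < depth U -> 0 <= shock_speed U V.
Proof.
move=> g0 [[_ /andP[b0 bU] velb] sb] WU bV VU.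
rewrite hugoniotE in velb.
(* Writing 0 as the speed of the still shock turns the goal into a comparison of two shocks with the
   same left state. *)
rewrite -sb (shock_speedEl velb) ?lt_eqF //.
rewrite (shock_speedEl (W2B_shock VU WU)) ?lt_eqF // lerD2l.
by apply: slopeM_homo => //; apply: lt_trans bU.
Qed.

Theorem theorem4p6 (R : realType) (g : R) (g_gt0 : 0 < g)
    (UL UR : state R) (hL_gt0 : 0 < depth UL) (hR_gt0 : 0 < depth UR)
    (aLR : bottom UL < bottom UR)
    (U1 U2 U3 U1bar : state R)
    (defU1 : [set U1] =
       SWset g (Cminus g `&` [set U | bottom U = bottom UL]) (bottom UR)
         `&` W2B g UR `&` A2 g)
    (U2C : Cminus g U2) (aU2 : bottom U2 = bottom UL)
    (U1SW : SW g U2 (bottom UR) U1)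
    (defU3 : [set U3] = W2B g U2 `&` W1 g UL)
    (defU1bar : S2_still g U1 U1bar)
    (hR_ge : depth U1bar <= depth UR)
    (h3_le : depth U3 <= depth U2) :
  admissible_solution g UL UR
    [:: Wave F1 UL U3; Wave F2 U3 U2; Wave F3 U2 U1; Wave F2 U1 UR]
  /\ rarefaction g F2 U3 U2.
Proof.
have [[_ U1W] [_ /andP[_ l2U1]]] :
    (SWset g (Cminus g `&` [set U | bottom U = bottom UL]) (bottom UR)
       `&` W2B g UR `&` A2 g) U1 by rewrite -defU1.
have [U3W2 U3W1] : (W2B g U2 `&` W1 g UL) U3 by rewrite -defU3.
have r32 : rarefaction g F2 U3 U2 by [].
have [bU1 U1_gt0 _] := U1SW; have [bU3 _ _] := U3W1; have [U2_gt0 uU2] := U2C.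
have vU2 : vel U2 != 0 by rewrite uU2 oppr_eq0 gt_eqF // sqrtr_gt0 mulr_gt0.
split=> //; split=> //=.
- split; rewrite /admissible_wave /=.
    (* Equal depths, the trivial wave, count as a rarefaction. *)
    case: (ltP (depth UL) (depth U3)) => d; last by right.
    by left; have [] := lax_shock_F1 g_gt0 hL_gt0 d U3W1.
  split; first by right.
  split; first exact: SW_stationary U1SW.
  split=> //; case: (ltP (depth UR) (depth U1)) => d; last by right.
  by left; apply: lax_shock_F2.
- split.
    (* The speeds of the 1-wave are at most [vel U3] or [lambda g F1 U3], hence at most
       [lambda g F2 U3], where the 2-rarefaction starts. *)
    move=> s s' /= s1 [[l _]|[_ /andP[+ _]]].
      by have := rarefaction_not_lax g_gt0 r32 l.
    apply: le_trans; case: s1 => [[l ->]|[_ /andP[_ ls]]].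
      case: (ltP (depth UL) (depth U3)) => d.
        have [_ sv] := lax_shock_F1 g_gt0 hL_gt0 d U3W1.
        by rewrite (le_trans sv) // lerDl sqrtr_ge0.
      by have := @rarefaction_not_lax _ g F1 UL U3 g_gt0 (conj U3W1 d) l.
    by rewrite (le_trans ls) // lerD2l ge0_cp ?sqrtr_ge0.
  split.
    move=> s s' /= s1 ->; case: s1 => [[l _]|[_ /andP[_ ls]]].
      by have := rarefaction_not_lax g_gt0 r32 l.
    by move: ls; rewrite -[X in _ <= X -> _]/(lambda g F2 U2) lambda2_Cminus.
  (* A final rarefaction starts at [lambda g F2 U1], positive because [U1] lies in [A2]; only the
     shock case uses [U1bar]. *)
  split=> // s s' /= -> [[l ->]|[_ /andP[ls _]]].
    case: (ltP (depth UR) (depth U1)) => d.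
      exact: shock_speed_ge0 defU1bar U1W hR_ge d.
    by have := @rarefaction_not_lax _ g F2 U1 UR g_gt0 (conj U1W d) l.
  exact: le_trans (ltW l2U1) ls.
- split.
    by do !split=> //; move=> _; apply: monotone_bottom_critical.
  (* Only the stationary wave changes the bottom level. *)
  rewrite !big_cons big_nil /= bU3 aU2 bU1 !subrr !normr0 !add0r !addr0.
  exact: distrC.
Qed.
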